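(* There exist absolute constants $c, C_1, C_2 > 0$ such that for every number of cups $n$ and every positive integer $k \le c\cdot n$, the filler in the variable-processor cup game on $n$ cups (starting from all fills $0$) has a strategy which, against every emptying strategy, guarantees that the backlog is at least $C_1 k$ within at most $C_2\left(k + \frac{k^3}{\log^2(n/k)}\right)$ rounds.
   Context: The (standard) variable-processor cup game on $n$ cups: there are $n$ cups with real fills $x_1,\dots,x_n$, all initially $0$, and two adaptive players (each sees the full current state), a filler and an emptier. In each round the filler chooses an integer $1\le p\le n$ and reals $a_1,\dots,a_n\in[0,1]$ with $\sum_i a_i = p$, and replaces each $x_i$ by $x_i+a_i$; then the emptier chooses a set $S\subseteq[n]$ of exactly $p$ cups and replaces $x_i$ by $\max(0,x_i-1)$ for each $i\in S$. The backlog of a state is $\max_i x_i$. The filler wants to maximize the backlog, the emptier to minimize it. *)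

(* Defs.v *)
From Stdlib Require Import Reals.
From mathcomp Require Import all_boot all_order all_algebra.
From mathcomp Require Import Rstruct.

Set Implicit Arguments.
Unset Strict Implicit.
Unset Printing Implicit Defensive.
Local Open Scope R_scope.

Definition cstate (n : nat) := 'I_n -> R.

Definition init_state (n : nat) : cstate n := fun _ => 0.

(* A filler move: a number of processors p and the amounts a_i. *)
Definition fmove (n : nat) := (nat * ('I_n -> R))%type.

Definition valid_fmove (n : nat) (m : fmove n) : Prop :=
  (1 <= m.1 <= n)%N /\
  (forall i, 0 <= m.2 i <= 1) /\
  (\sum_(i < n) m.2 i)%R = INR m.1.

Definition valid_emove (n : nat) (m : fmove n) (S : {set 'I_n}) : Prop :=
  #|S| = m.1.

(* Strategies are adaptive: they see the whole history of states
   x_0, ..., x_t (the last one being the current state); the emptier also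
   sees the current filler move. *)
Definition filler_strategy (n : nat) := seq (cstate n) -> fmove n.
Definition emptier_strategy (n : nat) := seq (cstate n) -> fmove n -> {set 'I_n}.

Definition valid_filler (n : nat) (F : filler_strategy n) : Prop :=
  forall h, valid_fmove (F h).

Definition valid_emptier (n : nat) (E : emptier_strategy n) : Prop :=
  forall h m, valid_fmove m -> valid_emove m (E h m).

Definition round (n : nat) (x : cstate n) (a : 'I_n -> R) (S : {set 'I_n})
  : cstate n :=
  fun i => if i \in S then Rmax 0 (x i + a i - 1) else x i + a i.

Fixpoint history (n : nat) (F : filler_strategy n) (E : emptier_strategy n)
    (t : nat) : seq (cstate n) :=
  match t with
  | 0 => [:: (@init_state n)]
  | t'.+1 =>
      let h := history F E t' in
      let x := last ((@init_state n)) h in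
      let m := F h in
      rcons h (round x m.2 (E h m))
  end.

Definition state_at (n : nat) (F : filler_strategy n) (E : emptier_strategy n)
    (t : nat) : cstate n :=
  last ((@init_state n)) (history F E t).

(* Backlog = max fill (0 for n = 0; fills are always >= 0). *)
Definition backlog (n : nat) (x : cstate n) : R :=
  \big[Rmax/0]_(i < n) x i.

(* Main.v *)
Require Import Defs.
From Stdlib Require Import Reals ClassicalEpsilon Lra.
From mathcomp Require Import all_boot all_order all_algebra.
From mathcomp Require Import Rstruct.
From mathcomp Require Import lra ring.

Set Implicit Arguments.
Unset Strict Implicit.
Unset Printing Implicit Defensive.
Import Order.TTheory GRing.Theory Num.Theory.

(** Let L = ln (n / k) and w = 1 + k / L. Call level j crowded if at least
    16^-j n cups have fill at least j w. The filler climbs from a crowded level J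
    to a higher one in O(w^3) rounds, whatever the number of cups.

    Let A be the set of cups with fill at least J w, and consider the potential
    sum over A of max(0, x_i - (J - 6) w)^2. As long as no higher level is crowded,
    the fills of A have geometric tails above J w, so the potential is O(w^2 |A|);
    since the total fill of A never decreases, a constant fraction of A lies in
    an interval of length 6 w, and some window of length 1/8 contains 2h cups of A
    with h of order |A| / w. The filler puts 1 into every cup of A above this
    window and 1/2 into these 2h cups, with p = #above + h. By convexity the
    emptier's best answer is to empty the cups above and half of the window, and
    the potential still grows by h / 4. This can last O(w^3) rounds only.

    At most k / (8 w) + 1 climbs are needed, hence O(k w^2) = O(k + k^3 / L^2)
    rounds; until fill k / 8 is reached, 16^J <= (n / k)^(1/2), so the crowded
    level has many more than w cups. *)

(** * Potential gain of one filler move, and the profile of an uncrowded state *)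

Section Spreading.
Local Open Scope ring_scope.

Variables (K : archiRealFieldType) (T : finType).
Implicit Types (A U G S : {set T}) (u v z : T -> K) (w g : K).

Definition possq (u : K) : K := Num.max 0 u ^+ 2.

Lemma possq_ge0 x : 0 <= possq x.
Proof. exact: sqr_ge0. Qed.

Lemma possq_pos x : 0 <= x -> possq x = x ^+ 2.
Proof. by move=> x0; rewrite /possq max_r. Qed.

Lemma possq_neg x : x <= 0 -> possq x = 0.
Proof. by move=> x0; rewrite /possq max_l // expr0n. Qed.

Lemma possq_mono x y : x <= y -> possq x <= possq y.
Proof.
move=> xy; rewrite /possq ler_sqr ?nnegrE; first last.
- by rewrite le_max lexx.
- by rewrite le_max lexx.
by rewrite ge_max !le_max lexx xy orbT.
Qed.

(* The weight 2 g + 1 / 4 is the drop of [possq] from g + 5 / 8 to g - 3 / 8, where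
   g + 5 / 8 is the top of the window after the half unit of fill: by convexity
   cups above drop by more, all others by less. Charging this weight for every
   emptied cup makes the estimate independent of which cups are emptied. *)
Lemma possq_step g x y (inU inG inS : bool) :
    1 <= g -> inU = (g + 1 / 8 <= x) -> (inG -> g <= x < g + 1 / 8) ->
    x + (if inU then 1 else if inG then 1 / 2 else 0) - inS%:R <= y ->
  possq x + inU%:R * (2 * g + 1 / 4) + inG%:R * (g + 1 / 4)
    - inS%:R * (2 * g + 1 / 4) <= possq y.
Proof.
move=> g1 -> hG /possq_mono; apply: le_trans.
case: (leP (g + 1 / 8) x) hG => hx /=.
  case: inG => [/(_ isT)|_]; first by rewrite andbF.
  by case: inS => /=; rewrite !possq_pos; lra.
case: inG => [/(_ isT)/andP[hg _]|_].
  by case: inS => /=; rewrite !possq_pos; lra.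
case: inS => /=; last by rewrite addr0 subr0 !mul0r !addr0 subr0.
have [x0|x0] := leP x 0; first by rewrite !possq_neg; lra.
have [x1|x1] := leP x 1; last by rewrite !possq_pos; lra.
have xx : x * x <= x * 1 by rewrite ler_wpM2l // ltW.
by rewrite (@possq_neg (_ + _ - _)) ?(possq_pos (ltW x0)); lra.
Qed.

Lemma sum_indicator A (P : pred T) :
  \sum_(i in A) (P i)%:R = #|[set i in A | P i]|%:R :> K.
Proof.
rewrite -[#|_|]sum1_card natr_sum [LHS]big_mkcond [RHS]big_mkcond.
by apply: eq_bigr => i _; rewrite inE; case: (i \in A); case: (P i).
Qed.

Definition spread_fill U G (i : T) : K :=
  if i \in U then 1 else if i \in G then 1 / 2 else 0.

Lemma spread_fill_itv U G i : 0 <= spread_fill U G i <= 1.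
Proof. by rewrite /spread_fill; do 2?case: ifP => _; lra. Qed.

Lemma spread_fill_sum A U G (h : nat) : U \subset A -> G \subset A ->
    [disjoint U & G] -> #|G| = h.*2 ->
  \sum_(i in A) spread_fill U G i = (#|U| + h)%:R /\
  \sum_i spread_fill U G i = (#|U| + h)%:R.
Proof.
move=> UA GA dUG cG.
have E (B : {set T}) : U \subset B -> G \subset B ->
    \sum_(i in B) spread_fill U G i = (#|U| + h)%:R.
  move=> UB GB.
  have -> : (#|U| + h)%:R = \sum_(i in U) (1 : K) + \sum_(i in G) (1 / 2).
    by rewrite !sumr_const cG natrD -[_ *+ h.*2]mulr_natr -muln2 natrM; field.
  rewrite (big_mkcond (fun i => i \in U)) (big_mkcond (fun i => i \in G)).
  rewrite -big_split big_mkcond; apply: eq_bigr => i _ /=.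
  rewrite /spread_fill; case: ifP => iB.
    case: ifP => iU; last by rewrite add0r.
    by rewrite (disjointFr dUG iU) addr0.
  case: ifP => [/(subsetP UB)|_]; first by rewrite iB.
  by case: ifP => [/(subsetP GB)|_]; rewrite ?iB ?addr0.
split; first exact: E.
by rewrite -(E [set: T]) ?subsetT //; apply: eq_bigl => i; rewrite inE.
Qed.

Lemma above_window_disjoint A G u g :
    (forall i, i \in G -> g <= u i < g + 1 / 8) ->
  [disjoint [set i in A | g + 1 / 8 <= u i] & G].
Proof.
move=> Gwin; rewrite disjoint_sym disjoint_subset; apply/subsetP => i iG.
have /andP[_] := Gwin i iG.
by rewrite !inE ltNge => /negPf ->; rewrite andbF.
Qed.

(** All [#|U| + h] units of fill go into [A], while emptying removes at most that many. For the
    potential, sum [possq_step]: the charges on [U] cancel, and the rest is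
    [2h (g + 1/4) - h (2g + 1/4) = h / 4]. *)
Lemma spread_gain A G S u v g (h : nat) (U := [set i in A | g + 1 / 8 <= u i]) :
    1 <= g -> G \subset A -> #|G| = h.*2 ->
    (forall i, i \in G -> g <= u i < g + 1 / 8) ->
    #|S| = (#|U| + h)%N ->
    (forall i, u i + spread_fill U G i - (i \in S)%:R <= v i) ->
  \sum_(i in A) u i <= \sum_(i in A) v i /\
  \sum_(i in A) possq (u i) + h%:R / 4 <= \sum_(i in A) possq (v i).
Proof.
move=> g1 GA cG Gwin cS uv.
have UA : U \subset A by apply/subsetP => i; rewrite inE => /andP[].
have dUG : [disjoint U & G] by apply: above_window_disjoint.
have countin (B : {set T}) (c : K) : B \subset A ->
    \sum_(i in A) (i \in B)%:R * c = #|B|%:R * c.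
  move=> BA; rewrite -mulr_suml sum_indicator; congr (_%:R * c).
  apply: eq_card => i; rewrite inE.
  by apply/andP/idP => [[]//|iB]; split=> //; apply: (subsetP BA).
have countS (c : K) : 0 <= c -> \sum_(i in A) (i \in S)%:R * c <= (#|U| + h)%:R * c.
  move=> c0; rewrite -cS -mulr_suml ler_wpM2r // sum_indicator ler_nat.
  by apply/subset_leq_card/subsetP => i; rewrite inE => /andP[].
split.
  have [sA _] := spread_fill_sum UA GA dUG cG.
  apply: (@le_trans _ _ (\sum_(i in A) (u i + spread_fill U G i - (i \in S)%:R * 1))).
    rewrite sumrB big_split /= sA -addrA lerDl.
    by have := countS 1 ler01; lra.
  by apply: ler_sum => i _; rewrite mulr1; apply: uv.
set c := 2 * g + 1 / 4.
apply: (@le_trans _ _ (\sum_(i in A) (possq (u i) + (i \in U)%:R * c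
    + (i \in G)%:R * (g + 1 / 4) - (i \in S)%:R * c))).
  rewrite sumrB !big_split /= (countin U) // (countin G) // cG -muln2 natrM.
  have c0 : 0 <= c by rewrite /c; lra.
  by have := countS c c0; rewrite natrD /c; lra.
apply: ler_sum => i iA; apply: possq_step => //.
- by rewrite inE iA.
- exact: Gwin.
Qed.

(** Here [J i] is the integer part of [z i / w], and 0 for negative [z i]. Tails of ratio 1/16 beat
    weights of ratio 4. *)
Lemma geometric_tail A z w : 0 < w ->
    (forall j, (0 < j)%N ->
      #|[set i in A | j%:R * w <= z i]|%:R <= 16^-1 ^+ j * #|A|%:R :> K) ->
  exists2 J : T -> nat, forall i, z i < (J i).+1%:R * w &
    \sum_(i in A) 4 ^+ J i <= 5 / 4 * #|A|%:R :> K.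
Proof.
move=> w0 tail; exists (fun i => Num.truncn (z i / w)).
  by move=> i; rewrite -ltr_pdivrMr // truncnS_gt.
set J := fun i => Num.truncn (z i / w).
(* Capping at [N] allows induction. Raising the cap adds [3 * 4 ^ N] on at most
   [16^-1 ^+ N.+1 * #|A|] cups, a geometric series with sum [#|A| / 4]. *)
have E (N : nat) : \sum_(i in A) (4 : K) ^+ minn N (J i)
    <= #|A|%:R * (5 / 4 - 1 / 4 * 4^-1 ^+ N).
  elim: N => [|N IH].
    rewrite (eq_bigr (fun=> 1)) => [|i _]; last by rewrite min0n.
    by rewrite sumr_const expr0; lra.
  have step i : (4 : K) ^+ minn N.+1 (J i)
      <= 4 ^+ minn N (J i) + (N < J i)%N%:R * (3 * 4 ^+ N).
    case: (boolP (N < J i)%N) => [NJ|]; last rewrite -leqNgt => NJ.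
      by rewrite (minn_idPl NJ) (minn_idPl (ltnW NJ)) exprS mul1r; lra.
    by rewrite (minn_idPr NJ) (minn_idPr (leqW NJ)) mul0r addr0.
  apply: (le_trans (ler_sum _ (fun i _ => step i))).
  rewrite big_split /= -mulr_suml sum_indicator.
  have -> : #|[set i in A | N < J i]%N| = #|[set i in A | N.+1%:R * w <= z i]|.
    by apply: eq_card => i; rewrite !inE /J truncn_gt_nat ler_pdivlMr.
  have p4 : 0 < (4 : K) ^+ N by rewrite exprn_gt0.
  have := tail N.+1 isT => /(ler_wpM2r (_ : 0 <= 3 * 4 ^+ N)).
  move=> /(_ ltac:(lra)) tN.
  apply: (le_trans (lerD IH tN)).
  rewrite !exprS -[16]/((4 * 4)%N%:R) natrM invfM exprMn !exprVn.
  rewrite le_eqVlt; apply/orP; left; apply/eqP; field.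
  by rewrite !lt0r_neq0.
have [N hN] : exists N, forall i, (J i <= N)%N.
  by exists (\max_i J i) => i; apply: leq_bigmax.
have := E N; rewrite (eq_bigr (fun i => 4 ^+ J i)) => [/le_trans -> //|i _].
  rewrite mulrC ler_wpM2r ?ler0n // gerBl mulr_ge0 //; first by lra.
  by rewrite exprn_ge0 // invr_ge0.
by rewrite (minn_idPr (hN i)).
Qed.

Lemma possq_sum_le A z w (J : T -> nat) : 0 < w ->
    (forall i, z i < (J i).+1%:R * w) ->
    \sum_(i in A) 4 ^+ J i <= 5 / 4 * #|A|%:R :> K ->
  \sum_(i in A) possq (z i + 6 * w) <= 62 * w ^+ 2 * #|A|%:R.
Proof.
move=> w0 zJ sJ.
(* Squaring this gives the factor 49 below, and [49 * 5 / 4 <= 62]. *)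
have p2 (j : nat) : j%:R + 7 <= 7 * (2 : K) ^+ j.
  elim: j => [|j IH]; first by rewrite expr0; lra.
  by rewrite exprS -natr1; have := ler0n K j; lra.
apply: (@le_trans _ _ (\sum_(i in A) 49 * w ^+ 2 * 4 ^+ J i)).
  apply: ler_sum => i _.
  have h : z i + 6 * w <= 7 * 2 ^+ J i * w.
    have := zJ i; have := ler_wpM2r (ltW w0) (p2 (J i)); rewrite -natr1; lra.
  apply: (le_trans (possq_mono h)); rewrite possq_pos.
    have -> : (4 : K) ^+ J i = 2 ^+ J i * 2 ^+ J i.
      by rewrite -exprMn; congr (_ ^+ _); ring.
    by move: (2 ^+ J i) => t; lra.
  by rewrite !mulr_ge0 ?exprn_ge0 // ltW.
rewrite -mulr_sumr; have w2 : 0 < w ^+ 2 by rewrite exprn_gt0.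
have := ler_wpM2l (_ : 0 <= 49 * w ^+ 2) sJ => /(_ ltac:(lra)).
have := mulr_ge0 (ltW w2) (ler0n K #|A|); lra.
Qed.

(** Since the [z i] have nonnegative sum and light upper tails, few of them can be far below 0.
    Summing [pt] gives [#|A| <= #|B| + 5/8 #|A|]; then the pigeonhole principle applies to windows
    of length 1/8. The shift by [6 * w] puts [B] above [w], whence [1 <= g]. *)
Lemma crowded_window A z w (J : T -> nat) (h : nat) : 1 <= w ->
    (forall i, z i < (J i).+1%:R * w) ->
    \sum_(i in A) 4 ^+ J i <= 5 / 4 * #|A|%:R :> K ->
    0 <= \sum_(i in A) z i -> (0 < #|A|)%N -> h%:R * (400 * w) <= #|A|%:R ->
  exists g G, [/\ 1 <= g, G \subset A, #|G| = h.*2 &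
    forall i, i \in G -> g <= z i + 6 * w < g + 1 / 8].
Proof.
move=> w1 zJ sJ z0 A0 hA.
have w0 : 0 < w by lra.
pose B := [set i in A | - (5 * w) <= z i < w].
have cB : 3 / 8 * #|A|%:R <= #|B|%:R :> K.
  have j4 (j : nat) : j%:R + 1 <= (4 : K) ^+ j /\ ((0 < j)%N -> j%:R + 3 <= (4 : K) ^+ j).
    elim: j => [|j [IH _]]; first by rewrite expr0; split=> //; lra.
    by rewrite exprS -natr1; have := ler0n K j; split=> [|_]; lra.
  (* (4 ^ J i - z i / w) / 2 is nonnegative, and at least 1 outside [-5w, w[. *)
  have pt i : i \in A -> 1 <= (i \in B)%:R + (4 ^+ J i - z i / w) / 2.
    move=> iA; rewrite inE iA /=.
    have [p1 p2] := j4 (J i).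
    have zw : z i / w < (J i).+1%:R by rewrite ltr_pdivrMr.
    rewrite -natr1 in zw.
    case: (leP (- (5 * w)) (z i)) => [hl|hl] /=.
      case: (ltP (z i) w) => hu /=; first by lra.
      have : (0 < J i)%N.
        rewrite lt0n; apply/negP => /eqP Ji0; have := zJ i.
        by rewrite Ji0; lra.
      by move=> /p2; lra.
    have : z i / w < - 5 by rewrite ltr_pdivrMr //; lra.
    have := exprn_ege1 (J i) (_ : 1 <= 4 :> K) => /(_ ltac:(lra)); lra.
  have := ler_sum (index_enum T) pt; rewrite sumr_const big_split /= sum_indicator.
  have -> : #|[set i in A | i \in B]| = #|B|.
    by apply: eq_card => i; rewrite !inE andbA andbb.
  rewrite -mulr_suml sumrB -mulr_suml => hs.
  have : 0 <= (\sum_(i in A) z i) / w by rewrite divr_ge0 // ltW.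
  by lra.
pose N := (Num.truncn (48 * w)).+1.
pose win i := Num.truncn (8 * (z i + 5 * w)).
pose W (j : nat) := [set i in B | win i == j].
have winE i : i \in B -> (win i)%:R <= 8 * (z i + 5 * w) < (win i).+1%:R.
  by rewrite inE => /andP[_ /andP[hl _]]; apply: truncn_itv; lra.
have cW : #|B| = (\sum_(j < N) #|W j|)%N.
  have winN i : i \in B -> (win i < N)%N.
    move=> iB; rewrite ltnS /win truncn_le_nat.
    apply: lt_trans (truncnS_gt (48 * w)).
    by move: iB; rewrite inE => /andP[_ /andP[_ hu]]; lra.
  rewrite -sum1_card (partition_big (fun i => inord (win i) : 'I_N) xpredT) //=.
  apply: eq_bigr => j _; rewrite -sum1_card; apply: eq_bigl => i.
  rewrite [RHS]in_set; case iB: (i \in B) => //=.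
  by rewrite -val_eqE /= inordK //; apply: winN.
have [j hj] : exists j, (h.*2 <= #|W j|)%N.
  case: (pickP (fun j : 'I_N => (h.*2 <= #|W j|)%N)) => [j hj|none].
    by exists j.
  have : (#|B| <= N * h.*2)%N.
    rewrite cW -[N in (N * _)%N]card_ord -sum_nat_const; apply: leq_sum => j _.
    by apply: ltnW; rewrite ltnNge none.
  (* If every window had fewer than [2h] cups, [B] would have at most [98 w h <= 98/400 #|A|] of
     them, less than [3/8 #|A|]. *)
  rewrite -(ler_nat K) -muln2 !natrM => hB.
  have hN : N%:R <= 49 * w.
    have : (Num.truncn (48 * w))%:R <= 48 * w by rewrite truncn_le mulr_ge0 // ltW.
    have -> : N%:R = (Num.truncn (48 * w))%:R + 1 :> K by rewrite natr1.
    by lra.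
  have := ler_wpM2r (_ : 0 <= h%:R * 2%:R) hN => /(_ ltac:(by rewrite mulr_ge0)).
  have : 0 < #|A|%:R :> K by rewrite ltr0n.
  by lra.
have /card_geqP[s [us ss sW]] := hj.
exists (w + j%:R / 8), [set i in s]; split.
- by have := ler0n K j; lra.
- by apply/subsetP => i; rewrite inE => /sW; rewrite !inE -andbA => /andP[].
- by rewrite cardsE (card_uniqP us).
move=> i; rewrite inE => /sW; rewrite inE => /andP[iB /eqP wj].
by have := winE i iB; rewrite wj -[j.+1%:R]natr1 => /andP[h1 h2]; apply/andP; split; lra.
Qed.

Definition crowded w (j : nat) (x : T -> K) : Prop :=
  16^-1 ^+ j * #|T|%:R <= #|[set i | j%:R * w <= x i]|%:R :> K.

Lemma uncrowded_tail A w (J : nat) (y : T -> K) : 0 < w ->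
    16^-1 ^+ J * #|T|%:R <= #|A|%:R :> K ->
    ~ (exists2 J', (J < J')%N & crowded w J' y) ->
  exists2 L : T -> nat, forall i, y i - J%:R * w < (L i).+1%:R * w &
    \sum_(i in A) 4 ^+ L i <= 5 / 4 * #|A|%:R :> K.
Proof.
move=> w0 cA fail; apply: geometric_tail => // j j0.
apply: (@le_trans _ _ (16^-1 ^+ (J + j) * #|T|%:R)); last first.
  by rewrite addnC exprD -mulrA ler_wpM2l // exprn_ge0 // invr_ge0.
rewrite leNgt; apply/negP => /ltW hc; apply: fail; exists (J + j)%N.
  by rewrite -[J in (J < _)%N]addn0 ltn_add2l.
apply: (le_trans hc); rewrite ler_nat; apply/subset_leq_card/subsetP => i.
by rewrite !inE => /andP[_]; rewrite natrD; lra.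
Qed.

End Spreading.

(** * Forcing as a game tree, and its conversion into strategies *)

Section Forcing.

Variable n : nat.
Implicit Types (P Q : cstate n -> Prop) (x y : cstate n).

(** The emptier's replies are quantified round by round, without histories or strategies, so that
    forcing arguments can be chained. [P] may be reached before round [t]. *)
Fixpoint can_force P (t : nat) x : Prop :=
  P x \/
  if t is t'.+1 then
    exists2 m, valid_fmove m &
      forall S, valid_emove m S -> can_force P t' (round x m.2 S)
  else False.

Lemma can_force_now P t x : P x -> can_force P t x.
Proof. by case: t => [|t]; left. Qed.

Lemma can_force_leq P t t' x : (t <= t')%N -> can_force P t x -> can_force P t' x.
Proof.
elim: t t' x => [|t IH] [|t'] x //=; first by move=> _ [?|[]]; left.
move=> tt' [?|[m vm hm]]; [by left|right].
by exists m => // S vS; apply: IH (hm S vS).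
Qed.

Lemma can_force_trans P Q s t x : can_force P s x ->
  (forall y, P y -> can_force Q t y) -> can_force Q (s + t) x.
Proof.
move=> + PQ; elim: s x => [|s IH] x [Px|//].
- exact: PQ.
- by apply: can_force_leq (PQ x Px); rewrite leq_addl.
by case=> m vm hm; right; exists m => // S vS; apply: IH (hm S vS).
Qed.

Lemma can_force_weaken P Q t x : (forall y, P y -> Q y) ->
  can_force P t x -> can_force Q t x.
Proof.
move=> PQ fP; rewrite -[t]addn0; apply: can_force_trans fP _ => y Py.
exact/can_force_now/PQ.
Qed.

Lemma valid_fmove_full : (0 < n)%N -> valid_fmove (n, fun _ : 'I_n => 1%R).
Proof.
move=> n0; split=> /=; first by rewrite n0 leqnn.
split; first by move=> i; split; apply/RleP; rewrite ?ler01 ?lexx.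
by rewrite INRE big_const_ord iter_addr addr0.
Qed.

Lemma size_history (F : filler_strategy n) E t : size (history F E t) = t.+1.
Proof. by elim: t => //= t IH; rewrite size_rcons IH. Qed.

(** By choice, [F] plays after each history a move that keeps [P] forceable in the remaining time,
    if there is one. *)
Lemma strategy_of_can_force P T : (0 < n)%N -> can_force P T (@init_state n) ->
  exists F : filler_strategy n, valid_filler F /\
  forall E, valid_emptier E -> exists2 t, (t <= T)%N & P (state_at F E t).
Proof.
move=> n0 P0.
(* A history of size [t.+1] records [t] rounds, so [T - size h] rounds remain after the move [m]. *)
pose good h m := forall S, valid_emove m S ->
  can_force P (T - size h) (round (last (@init_state n) h) m.2 S).
have ex h : exists m, valid_fmove m /\
    ((exists2 m', valid_fmove m' & good h m') -> good h m).
  have [[m' vm' gm']|no] := classic (exists2 m', valid_fmove m' & good h m').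
    by exists m'.
  (* A default valid move for histories from which [P] cannot be forced in time. *)
  by exists (n, fun=> 1%R); split; [apply: valid_fmove_full|].
pose F h := proj1_sig (constructive_indefinite_description _ (ex h)).
have FP h : valid_fmove (F h) /\
    ((exists2 m', valid_fmove m' & good h m') -> good h (F h)).
  exact: (proj2_sig (constructive_indefinite_description _ (ex h))).
exists F; split=> [h|E vE]; first by have [] := FP h.
have inv t : (t <= T)%N -> (exists2 s, (s <= T)%N & P (state_at F E s)) \/
    can_force P (T - t) (state_at F E t); last first.
  by have := inv T (leqnn T); rewrite subnn; case=> // -[PT|//]; exists T.
elim: t => [_|t IH tT]; first by rewrite subn0; right.
have [?|] := IH (ltnW tT); first by left.
rewrite -(subnSK tT) => -[Pt|gt]; first by left; exists t; rewrite // ltnW.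
right; have [vF] := FP (history F E t).
rewrite {1 2}/good size_history => /(_ gt) gF.
by rewrite /state_at /= last_rcons; apply/gF/vE.
Qed.

End Forcing.

(** * One climb to a higher crowded level *)

Section Stage.
Local Open Scope ring_scope.

Variable n : nat.
Implicit Types (x y : cstate n).

(** Clipping at 0 only helps the filler; the gain estimate needs just this lower bound. *)
Lemma round_ge x a (S : {set 'I_n}) i :
  x i + a i - (i \in S)%:R <= round x a S i.
Proof.
rewrite /round RmaxE; case: (i \in S); last by rewrite subr0.
by rewrite le_max lexx orbT.
Qed.

Lemma crowded_step (w : R) (J : nat) x :
    1 <= w -> 400 * w <= 16^-1 ^+ J * n%:R -> crowded w J x ->
  can_force (fun y => exists2 J', (J < J')%N & crowded w J' y)
    (Num.truncn (500 * (400 * w ^+ 3))).+1 x.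
Proof.
move=> w1 nbig cJ.
have w0 : 0 < w by lra.
pose A := [set i | J%:R * w <= x i].
pose z (y : cstate n) i := y i - J%:R * w.
have Abig : 400 * w <= #|A|%:R by apply: le_trans cJ; rewrite card_ord.
have A0 : (0 < #|A|)%N by rewrite -(ltr0n R); lra.
pose h := Num.truncn (#|A|%:R / (400 * w)).
have w400 : 0 < 400 * w by lra.
have h1 : (0 < h)%N by rewrite truncn_gt0 ler_pdivlMr // mul1r.
have hA : h%:R * (400 * w) <= #|A|%:R.
  by rewrite -ler_pdivlMr // truncn_le divr_ge0 // ltW.
(* Rounding down costs at most a factor 2, because [h] is positive. *)
have Ah : #|A|%:R <= h%:R * (800 * w).
  have : #|A|%:R <= h.+1%:R * (400 * w) by rewrite -ler_pdivrMr // ltW // truncnS_gt.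
  rewrite -[h.+1%:R]natr1.
  have : 1 * (400 * w) <= h%:R * (400 * w) by rewrite ler_wpM2r ?ler1n // ltW.
  by lra.
pose done y := exists2 J', (J < J')%N & crowded w J' y.
(* With [t] rounds left, the potential plus all gains still to come exceeds the bound valid in
   uncrowded states. At [t = 0] this contradicts [possq_sum_le]. *)
have key t y : 0 <= \sum_(i in A) z y i ->
    62 * w ^+ 2 * #|A|%:R < \sum_(i in A) possq (z y i + 6 * w) + t%:R * (h%:R / 4) ->
    can_force done t y.
  elim: t y => [|t IH] y zy py.
    have [suc|/(uncrowded_tail w0 cJ)[Ji zJ sJ]] := classic (done y).
      exact: can_force_now.
    by have := possq_sum_le w0 zJ sJ; lra.
  have [suc|/(uncrowded_tail w0 cJ)[Ji zJ sJ]] := classic (done y).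
    exact: can_force_now.
  have [g [G [g1 GA cG Gwin]]] := crowded_window w1 zJ sJ zy A0 hA.
  pose u i := z y i + 6 * w.
  pose U := [set i in A | g + 1 / 8 <= u i].
  have UA : U \subset A by apply/subsetP => i; rewrite inE => /andP[].
  have dUG : [disjoint U & G] by apply: above_window_disjoint.
  pose a : 'I_n -> R := spread_fill _ U G.
  have sT : \sum_i a i = (#|U| + h)%:R.
    exact: (proj2 (@spread_fill_sum _ _ A U G h UA GA dUG cG)).
  right; exists ((#|U| + h)%N, a).
    split=> /=.
      (* At most [n] processors: [U] and [G] are disjoint and [G] has [2h] cups. *)
      rewrite addn_gt0 h1 orbT /= -[n in (_ <= n)%N]card_ord.
      apply: leq_trans (max_card (mem (U :|: G))).
      by rewrite cardsU disjoint_setI0 // cards0 subn0 leq_add2l cG -addnn leq_addr.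
    split; last by rewrite INRE.
    move=> i; have /andP[a0 a1] : 0 <= a i <= 1 := spread_fill_itv _ U G i.
    by split; apply/RleP.
  move=> S vS; pose v i := z (round y a S) i + 6 * w.
  have uv i : u i + a i - (i \in S)%:R <= v i.
    have shift (c d r s b e : R) : r + b - s <= e -> r - c + d + b - s <= e - c + d.
      by lra.
    exact: shift (round_ge y a S i).
  have [su sp] := spread_gain g1 GA cG Gwin vS uv.
  apply: IH; last by move: py sp; rewrite -[t.+1%:R]natr1 /u /v; lra.
  by apply: (le_trans zy); move: su; rewrite /u /v !big_split /= lerD2r.
apply: key.
  by apply: sumr_ge0 => i; rewrite inE /z subr_ge0.
(* By [Ah] the bound is at most [62 * 800 w^3 h = 49600 w^3 h], while [t] rounds gain
   [t * h / 4 = 50000 w^3 h]. *)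
set t := 500 * (400 * w ^+ 3).
have ht : t < (Num.truncn t).+1%:R by rewrite truncnS_gt.
have h0 : 0 < h%:R :> R by rewrite ltr0n.
have sum0 : 0 <= \sum_(i in A) possq (z x i + 6 * w).
  by apply: sumr_ge0 => i _; apply: possq_ge0.
have := ltr_pM2r h0 t (Num.truncn t).+1%:R; rewrite ht.
have w2 : 0 < w ^+ 2 by rewrite exprn_gt0.
have := ler_wpM2l (ltW w2) Ah.
have : 0 < w ^+ 3 * h%:R by rewrite mulr_gt0 // exprn_gt0.
rewrite /t; lra.
Qed.

End Stage.

(** * Iterated climbs and the backlog they give *)

Section Climb.
Local Open Scope ring_scope.

Variable n : nat.
Implicit Types (x y : cstate n).

Lemma crowded_init (w : R) : crowded w 0 (@init_state n).
Proof.
rewrite /crowded expr0 mul1r ler_nat.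
by apply/subset_leq_card/subsetP => i _; rewrite inE mul0r /init_state lexx.
Qed.

(** Each climb gains at least one level, so [s] climbs reach level [s] unless fill [b] is reached
    first; below [b] the hypothesis supplies enough cups for the next climb. *)
Lemma crowded_climb (w b : R) s x : 1 <= w ->
    (forall J, J%:R * w < b -> 400 * w <= 16^-1 ^+ J * n%:R) ->
    crowded w 0 x ->
  can_force (fun y => exists2 J, (s <= J)%N \/ b <= J%:R * w & crowded w J y)
    (s * (Num.truncn (500 * (400 * w ^+ 3))).+1) x.
Proof.
move=> w1 nbig c0; elim: s => [|s IH].
  by apply: can_force_now; exists 0%N => //; left.
rewrite mulSnr; apply: can_force_trans IH _ => y [J sJ cJ].
have [bJ|Jb] := leP b (J%:R * w).
  by apply: can_force_now; exists J => //; right.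
case: sJ => [sJ|]; last by rewrite leNgt Jb.
apply: (can_force_weaken _ (crowded_step w1 (nbig J Jb) cJ)).
by move=> y' [J' JJ' cJ']; exists J' => //; left; apply: leq_ltn_trans JJ'.
Qed.

Lemma backlog_ge x i : x i <= backlog x.
Proof.
rewrite /backlog; have : i \in index_enum 'I_n by rewrite mem_index_enum.
elim: (index_enum _) => //= j r IH; rewrite inE big_cons RmaxE le_max.
by case/orP => [/eqP ->|/IH ->]; rewrite ?lexx ?orbT.
Qed.

Lemma crowded_backlog (w : R) J x : (0 < n)%N -> crowded w J x ->
  J%:R * w <= backlog x.
Proof.
move=> n0 cJ; have : (0 < #|[set i | J%:R * w <= x i]%R|)%N.
  rewrite -(ltr0n R); apply: lt_le_trans cJ.
  by rewrite card_ord mulr_gt0 ?ltr0n // exprn_gt0 // invr_gt0.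
case/card_gt0P => i; rewrite inE => /le_trans; apply.
exact: backlog_ge.
Qed.

Lemma force_backlog (w b : R) : (0 < n)%N -> 1 <= w ->
    (forall J, J%:R * w < b -> 400 * w <= 16^-1 ^+ J * n%:R) ->
  exists F : filler_strategy n, valid_filler F /\
  forall E, valid_emptier E -> exists2 t,
    (t <= (Num.truncn (b / w)).+1 * (Num.truncn (500 * (400 * w ^+ 3))).+1)%N &
    b <= backlog (state_at F E t).
Proof.
move=> n0 w1 nbig.
have w0 : 0 < w by lra.
have [F [vF hF]] := strategy_of_can_force n0
  (crowded_climb (Num.truncn (b / w)).+1 w1 nbig (crowded_init w)).
exists F; split=> // E vE; have [t tT [J bJ cJ]] := hF E vE.
exists t => //; apply: le_trans (crowded_backlog n0 cJ).
(* The number of climbs was chosen above [b / w]. *)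
case: bJ => // sJ; rewrite -ler_pdivrMr //.
by apply: le_trans (ltW (truncnS_gt _)) _; rewrite ler_nat.
Qed.

End Climb.

(** * Exponential and logarithm estimates *)

Section Logarithm.
Local Open Scope R_scope.

Lemma pow16_le_exp (J : nat) : 16 ^ J <= exp (4 * INR J).
Proof.
have e1 : 2 <= exp 1 by have := exp_ineq1 1; Lra.lra.
have e4 : 16 <= exp 4.
  have -> : 4 = 1 + 1 + (1 + 1) by Lra.lra.
  rewrite !exp_plus; have : 2 * 2 <= exp 1 * exp 1 by apply: Rmult_le_compat; Lra.lra.
  move=> e2; have : 4 * 4 <= exp 1 * exp 1 * (exp 1 * exp 1); last by Lra.lra.
  by apply: Rmult_le_compat; Lra.lra.
elim: J => [|J IH]; first by rewrite Rmult_0_r exp_0; Lra.lra.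
rewrite S_INR Rmult_plus_distr_l Rmult_1_r exp_plus /= Rmult_comm.
apply: Rmult_le_compat => //; last by Lra.lra.
by apply: pow_le; Lra.lra.
Qed.

Lemma pow16_le_exp_half (l : R) (J : nat) : 8 * INR J <= l -> 16 ^ J <= exp (l / 2).
Proof.
move=> h; apply: Rle_trans (pow16_le_exp J) _.
have : 4 * INR J <= l / 2 by Lra.lra.
by case=> [h'|->]; [left; apply: exp_increasing|right].
Qed.

Lemma half_exp_ln (r : R) : 640000 <= r ->
  [/\ 1 <= ln r, 800 <= exp (ln r / 2) & exp (ln r / 2) * exp (ln r / 2) = r].
Proof.
move=> r1; have E : exp (ln r / 2) * exp (ln r / 2) = r.
  by rewrite -exp_plus -{3}(exp_ln r); [congr exp|]; Lra.lra.
have p := exp_pos (ln r / 2).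
split=> //; last first.
  apply: Rnot_lt_le => h.
  by have := Rmult_le_0_lt_compat _ _ _ _ (Rlt_le _ _ p) (Rlt_le _ _ p) h h; Lra.lra.
rewrite -(ln_exp 1); have := exp_le_3 => e3.
by left; apply: ln_increasing; [apply: exp_pos|Lra.lra].
Qed.

End Logarithm.

(** * Round count and size of the crowded level *)

Section Rounds.
Local Open Scope ring_scope.

(** The witness [q] is the square root of [r], taken as [exp (ln r / 2)] to compare it with powers
    of 16. *)
Lemma exp_half_ln (r : R) : 800 * 800 <= r -> exists q : R,
  [/\ 1 <= ln r, 800 <= q, q * q = r & forall J, 8 * J%:R <= ln r -> 16 ^+ J <= q].
Proof.
have N (m : nat) : m%:R = IZR (Z.of_nat m) by rewrite -INRE INR_IZR_INZ.
rewrite (N 800) => /RleP; rewrite -RmultE -mult_IZR => /half_exp_ln[l1 q1 qq].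
exists (exp (Rdiv (ln r) 2)); split=> //; try exact/RleP.
move=> J; rewrite (N 8) (N 16) -INRE => /RleP h; apply/RleP; rewrite -RpowE.
exact: pow16_le_exp_half.
Qed.

(** Up to the factor [600 * 400], the product is [w^2 (k / 8 + w)]. Here [w^2 <= 2 (1 + (k / L)^2)]
    and [k / 8 + w <= 3 k], so the constant is [600 * 400 * 6 = 1200 * 1200]. *)
Lemma climb_rounds (K : archiRealFieldType) (k L w : K) :
    1 <= k -> 1 <= L -> w = 1 + k / L ->
  ((Num.truncn (k / 8 / w)).+1 * (Num.truncn (500 * (400 * w ^+ 3))).+1)%:R
    <= 1200 * 1200 * (k + k ^+ 3 / L ^+ 2).
Proof.
move=> k1 L1 wE.
have L0 : 0 < L by lra.
have q0 : 0 <= k / L by rewrite divr_ge0 //; lra.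
have qk : k / L <= k by rewrite ler_pdivrMr // ler_peMr //; lra.
have w1 : 1 <= w by rewrite wE; lra.
have wk : w <= 2 * k by rewrite wE; lra.
have w0 : 0 < w by lra.
have w3 : 1 <= w ^+ 3 by rewrite exprn_ege1.
have s1 : (Num.truncn (k / 8 / w)).+1%:R <= k / 8 / w + 1.
  by rewrite -[_.+1%:R]natr1 lerD2r truncn_le !divr_ge0 //; lra.
have s2 : (Num.truncn (500 * (400 * w ^+ 3))).+1%:R <= 600 * (400 * w ^+ 3).
  have : (Num.truncn (500 * (400 * w ^+ 3)))%:R <= 500 * (400 * w ^+ 3).
    by rewrite truncn_le; lra.
  by rewrite -[(Num.truncn _).+1%:R]natr1; lra.
rewrite natrM; apply: (le_trans (ler_pM (ler0n _ _) (ler0n _ _) s1 s2)).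
have E1 : (k / 8 / w + 1) * (600 * (400 * w ^+ 3))
    = 600 * (400 * (w ^+ 2 * (k / 8 + w))).
  by field; rewrite lt0r_neq0.
have E2 : k ^+ 3 / L ^+ 2 = k * (k / L) ^+ 2 by field; rewrite lt0r_neq0.
have w2 : w ^+ 2 <= 2 * (1 + (k / L) ^+ 2).
  by have := sqr_ge0 (1 - k / L); rewrite wE; lra.
have w2k : w ^+ 2 * (k / 8 + w) <= 2 * (1 + (k / L) ^+ 2) * (3 * k).
  by apply: ler_pM => //; rewrite ?exprn_ge0 //; lra.
rewrite E1 E2; lra.
Qed.

(** As [w] exceeds [k / L], the bound on [J * w] forces [8 J <= L], hence [16 ^+ J <= q]. With
    [w <= 2 k], this gives [400 w * 16 ^+ J <= 800 k q <= k q^2 = n]. *)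
Lemma crowd_survives (K : archiRealFieldType) (n k L w q : K) (J : nat) :
    1 <= k -> 1 <= L -> w = 1 + k / L -> 800 <= q -> n = k * (q * q) -> J%:R * w < k / 8 ->
    (8 * J%:R <= L -> 16 ^+ J <= q) ->
  400 * w <= 16^-1 ^+ J * n.
Proof.
move=> k1 L1 wE q1 nE Jw hJ.
have q0 : 0 < q by lra.
have L0 : 0 < L by lra.
have q'0 : 0 <= k / L by rewrite divr_ge0 //; lra.
have qk : k / L <= k by rewrite ler_pdivrMr // ler_peMr //; lra.
have wk : w <= 2 * k by rewrite wE; lra.
have J0 : 0 <= J%:R :> K by [].
have Jq : 16 ^+ J <= q.
  apply: hJ; have : J%:R * (k / L) <= k / 8.
    have : J%:R * w = J%:R + J%:R * (k / L) by rewrite wE; ring.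
    by lra.
  rewrite mulrA ler_pdivrMr // => h.
  have : k * (8 * J%:R) <= k * L by lra.
  by rewrite ler_pM2l //; lra.
have p16 : 0 < (16 : K) ^+ J by rewrite exprn_gt0.
rewrite exprVn [_^-1 * _]mulrC ler_pdivlMr // nE.
have : 400 * w * 16 ^+ J <= k * q * q.
  apply: ler_pM => //; [by rewrite wE; lra|exact: ltW|].
  have : k * 800 <= k * q by rewrite ler_pM2l //; lra.
  by lra.
by rewrite mulrA.
Qed.

End Rounds.

Local Open Scope R_scope.

Theorem theorem5p1 :
  exists c C1 C2 : R, 0 < c /\ 0 < C1 /\ 0 < C2 /\
  forall (n k : nat), (0 < k)%N -> INR k <= c * INR n ->
  exists F : filler_strategy n, valid_filler F /\
  forall E : emptier_strategy n, valid_emptier E ->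
  exists t : nat,
    INR t <= C2 * (INR k + INR k ^ 3 / (ln (INR n / INR k)) ^ 2) /\
    C1 * INR k <= backlog (state_at F E t).
Proof.
(* This [c] makes the square root of [n / k] at least 800, as [crowd_survives] requires; 1/8 keeps
   the levels low enough there. *)
exists (800 * 800)^-1%R, 8^-1%R, (1200 * 1200)%R.
do 3![split; first by apply/RltP; rewrite ?invr_gt0 ?mulr_gt0 ?ltr0n].
move=> n k k0; rewrite !INRE RmultE !RpowE !RdivE RplusE => /RleP kn.
have kR : (1 <= k%:R :> R)%R by rewrite ler1n.
have kR0 : (0 < k%:R :> R)%R by rewrite ltr0n.
have n0 : (0 < n)%N.
  rewrite lt0n; apply/eqP => n0; move: kn; rewrite n0 mulr0.
  by rewrite leNgt ltr0n k0.
have [|q [L1 q1 qq pJ]] := @exp_half_ln (n%:R / k%:R)%R.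
  by rewrite ler_pdivlMr // -ler_pdivlMl ?mulr_gt0.
set L := ln _ in L1 pJ *.
pose w := (1 + k%:R / L)%R.
have w1 : (1 <= w)%R by rewrite lerDl divr_ge0 ?ler0n //; lra.
have nE : (n%:R = k%:R * (q * q))%R by rewrite qq mulrC divfK // lt0r_neq0.
have [J Jw|F [vF hF]] := @force_backlog n w (k%:R / 8)%R n0 w1.
  exact: (crowd_survives kR L1 erefl q1 nE Jw (pJ J)).
exists F; split=> // E vE; have [t tT bt] := hF E vE; exists t.
rewrite INRE; split; apply/RleP; last by rewrite RmultE mulrC.
by apply: le_trans (climb_rounds kR L1 (erefl w)); rewrite ler_nat.
Qed.
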